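(* Let $f\in\mathbb{C}[z_1,z_1^{-1},\ldots,z_r,z_r^{-1}]$. Both the families $\{\mathcal{SA}_{\tilde f_n}\mid n\in\mathbb{Z}_+\}$ and $\{\mathcal{LA}_{\tilde f_n}\mid n\in\mathbb{Z}_+\}$ converge uniformly to $\mathcal{A}_f$ as $n\to\infty$. That is, each of these sets contains $\mathcal{A}_f$, and for every $\varepsilon>0$ there is $N$ such that for all $n\ge N$ every point of $\mathcal{SA}_{\tilde f_n}$, and every point of $\mathcal{LA}_{\tilde f_n}$, is at distance less than $\varepsilon$ from $\mathcal{A}_f$.
   Context: $\mathrm{Log}:(\mathbb{C}^* )^r\to\mathbb{R}^r$ is $\mathrm{Log}(z_1,\ldots,z_r)=(\log|z_1|,\ldots,\log|z_r|)$. The amoeba $\mathcal{A}_f$ is $\mathrm{Log}(Z_f)$, where $Z_f\subset(\mathbb{C}^* )^r$ is the zero locus of $f$. For a Laurent polynomial $g$ written as a sum of monomials $g=m_1+\cdots+m_s$ (nonzero coefficients, distinct exponent vectors) and $\mathbf{a}\in\mathbb{R}^r$, $g\{\mathbf{a}\}$ is the list of positive real numbers $\{|m_1(\mathbf{z})|,\ldots,|m_s(\mathbf{z})|\}$ for any $\mathbf{z}\in\mathrm{Log}^{-1}(\mathbf{a})$ (independent of the choice). A list of positive numbers is lopsided if one of the numbers is greater than the sum of all the others (an empty sum is $0$). A list of $s+1$ positive numbers is superlopsided if it has an entry $b_i$ with $b_i>s\,b_j$ for all $j\neq i$. The empty list is neither lopsided nor superlopsided. Set $\mathcal{LA}_g=\{\mathbf{a}\in\mathbb{R}^r\mid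 g\{\mathbf{a}\}\text{ is not lopsided}\}$ and $\mathcal{SA}_g=\{\mathbf{a}\in\mathbb{R}^r\mid g\{\mathbf{a}\}\text{ is not superlopsided}\}$. For a positive integer $n$, $\tilde f_n(\mathbf{z})=\prod_{k_1=0}^{n-1}\cdots\prod_{k_r=0}^{n-1}f(e^{2\pi i k_1/n}z_1,\ldots,e^{2\pi i k_r/n}z_r)$. The distance from a point to the empty set is $+\infty$. *)

(* Defs.v *)
From HB Require Import structures.
From mathcomp Require Import all_boot all_order all_algebra.
From mathcomp Require Import finmap.
From mathcomp Require Import monalg.
From mathcomp Require Import all_classical all_reals all_analysis.
From mathcomp Require Import complex.

Set Implicit Arguments.
Unset Strict Implicit.
Unset Printing Implicit Defensive.

Import Order.TTheory GRing.Theory Num.Theory.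
Import ComplexField.Normc.

Local Open Scope classical_set_scope.
Local Open Scope ring_scope.
Local Open Scope complex_scope.

(* C[z_1^{+-1}, ..., z_r^{+-1}] as finitely supported functions on Z^r.
   The product of monalg does not apply, because a monomType has no
   invertible elements besides 1; the ring structure is built here. *)
Definition laurent (R : realType) (r : nat) : Type := {malg R[i]['rV[int]_r]}.

HB.instance Definition _ (R : realType) (r : nat) :=
  GRing.Zmodule.copy (laurent R r) {malg R[i]['rV[int]_r]}.

Section LaurentRing.
Variables (R : realType) (r : nat).
Implicit Types (f g h : laurent R r) (c : R[i]) (e : 'rV[int]_r).

Definition laurent_one : laurent R r := << 1 *g 0 >>.

Definition laurent_mul f g : laurent R r :=
  \sum_(d <- msupp f) \sum_(e <- msupp g) << f@_d * g@_e *g d + e >>.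

Lemma laurent_mulw (D E : {fset 'rV[int]_r}) f g :
  (msupp f `<=` D)%fset -> (msupp g `<=` E)%fset ->
  laurent_mul f g = \sum_(d <- D) \sum_(e <- E) << f@_d * g@_e *g d + e >>.
Proof.
move=> leD leE; rewrite /laurent_mul (big_fset_incl _ leD) /=.
  apply/eq_bigr => d _; apply/big_fset_incl => // e _ /mcoeff_outdom ->.
  by rewrite mulr0 monalgU0.
move=> d _ /mcoeff_outdom fd.
by rewrite big1 => // e _; rewrite fd mul0r monalgU0.
Qed.

Lemma laurent_mulDl : left_distributive laurent_mul +%R.
Proof.
move=> f1 f2 g.
rewrite (laurent_mulw (msuppD_le f1 f2) (fsubset_refl _)).
rewrite (laurent_mulw (fsubsetUl (msupp f1) (msupp f2)) (fsubset_refl _)).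
rewrite (laurent_mulw (fsubsetUr (msupp f1) (msupp f2)) (fsubset_refl _)).
rewrite -big_split /=; apply/eq_bigr => d _.
rewrite -big_split /=; apply/eq_bigr => e _.
by rewrite mcoeffD mulrDl monalgUD.
Qed.

Lemma laurent_mulC : commutative laurent_mul.
Proof.
move=> f g; rewrite /laurent_mul exchange_big /=.
by apply/eq_bigr => d _; apply/eq_bigr => e _; rewrite mulrC addrC.
Qed.

Lemma laurent_mulDr : right_distributive laurent_mul +%R.
Proof. by move=> f g h; rewrite !(laurent_mulC f) laurent_mulDl. Qed.

Lemma laurent_mul0l : left_zero 0 laurent_mul.
Proof. by move=> f; rewrite /laurent_mul msupp0 big_seq_fset0. Qed.

Lemma laurent_mul0r : right_zero 0 laurent_mul.
Proof. by move=> f; rewrite laurent_mulC laurent_mul0l. Qed.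

Lemma laurent_mulUU c c' e e' :
  laurent_mul << c *g e >> << c' *g e' >> = << c * c' *g e + e' >>.
Proof. by rewrite (laurent_mulw msuppU_le msuppU_le) !big_seq_fset1 !mcoeffUU. Qed.

Lemma laurent_mul_suml I (s : seq I) (F : I -> laurent R r) g :
  laurent_mul (\sum_(i <- s) F i) g = \sum_(i <- s) laurent_mul (F i) g.
Proof.
exact: (big_morph (laurent_mul^~ g) (fun _ _ => laurent_mulDl _ _ _)
                  (laurent_mul0l g)).
Qed.

Lemma laurent_mul_sumr I (s : seq I) (F : I -> laurent R r) g :
  laurent_mul g (\sum_(i <- s) F i) = \sum_(i <- s) laurent_mul g (F i).
Proof.
exact: (big_morph (laurent_mul g) (fun _ _ => laurent_mulDr _ _ _)
                  (laurent_mul0r g)).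
Qed.

Lemma laurent_mulA : associative laurent_mul.
Proof.
move=> f g h; rewrite (monalgE f).
rewrite [LHS]laurent_mul_suml [X in _ = laurent_mul X h]laurent_mul_suml.
rewrite [RHS]laurent_mul_suml; apply/eq_bigr => d _.
rewrite (monalgE g) [X in laurent_mul _ X = _]laurent_mul_suml.
rewrite [LHS]laurent_mul_sumr [X in _ = laurent_mul X h]laurent_mul_sumr.
rewrite [RHS]laurent_mul_suml; apply/eq_bigr => e _.
rewrite laurent_mulUU (monalgE h) [X in laurent_mul _ X = _]laurent_mul_sumr.
rewrite [LHS]laurent_mul_sumr [RHS]laurent_mul_sumr.
by apply/eq_bigr => k _; rewrite !laurent_mulUU mulrA addrA.
Qed.

Lemma laurent_mul1 : left_id laurent_one laurent_mul.
Proof.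
move=> f; rewrite [X in laurent_mul _ X]monalgE laurent_mul_sumr [RHS]monalgE.
by apply/eq_bigr => e _; rewrite laurent_mulUU mul1r add0r.
Qed.

Lemma laurent_one_neq0 : laurent_one != 0.
Proof. by rewrite monalgU_eq0 oner_eq0. Qed.

HB.instance Definition _ := GRing.Zmodule_isComNzRing.Build (laurent R r)
  laurent_mulA laurent_mulC laurent_mul1 laurent_mulDl laurent_one_neq0.

End LaurentRing.

Section Amoebas.
Variables (R : realType) (r : nat).
Implicit Types (f g : laurent R r) (z u : 'rV[R[i]]_r) (a b : 'rV[R]_r)
  (e : 'rV[int]_r).

Definition torus : set 'rV[R[i]]_r := [set z | forall i, z 0 i != 0].

Definition monom z e : R[i] := \prod_(i < r) z 0 i ^ e 0 i.

Definition leval f z : R[i] := \sum_(e <- msupp f) f@_e * monom z e.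

Definition zero_locus f : set 'rV[R[i]]_r :=
  [set z | torus z /\ leval f z = 0].

Definition Log z : 'rV[R]_r := \row_i ln (normc (z 0 i)).

Definition amoeba f : set 'rV[R]_r := Log @` zero_locus f.

Definition term_norms g z : seq R :=
  [seq normc (g@_e * monom z e) | e <- msupp g].

(* g{a}, computed at the point z = (exp a_1, ..., exp a_r) of Log^{-1}(a);
   any other point gives the same list, see [list_at_Log]. *)
Definition list_at g a : seq R := term_norms g (\row_i (expR (a 0 i))%:C).

Definition lopsided (s : seq R) : Prop :=
  exists i : 'I_(size s), \sum_(j < size s | j != i) s`_j < s`_i.

Definition superlopsided (s : seq R) : Prop :=
  exists i : 'I_(size s), forall j : 'I_(size s), j != i ->
    (size s).-1%:R * s`_j < s`_i.

Definition LA g : set 'rV[R]_r := [set a | ~ lopsided (list_at g a)].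

Definition SA g : set 'rV[R]_r := [set a | ~ superlopsided (list_at g a)].

Definition expi (t : R) : R[i] := cos t +i* sin t.

(* The Laurent polynomial f(u_1 z_1, ..., u_r z_r), see [leval_rescale]. *)
Definition rescale u f : laurent R r :=
  \sum_(e <- msupp f) << f@_e * monom u e *g e >>.

Definition root_point n (k : {ffun 'I_r -> 'I_n}) : 'rV[R[i]]_r :=
  \row_i expi (2 * pi * (k i)%:R / n%:R).

Definition cyclic_prod n f : laurent R r :=
  \prod_(k : {ffun 'I_r -> 'I_n}) rescale (root_point k) f.

(* The norm that the library puts on 'rV[R]_r is the sup norm. *)
Definition eucl_dist a b : R := Num.sqrt (\sum_(i < r) (a 0 i - b 0 i) ^+ 2).

Definition dist_to (A : set 'rV[R]_r) a : \bar R :=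
  ereal_inf [set (eucl_dist a b)%:E | b in A].

Definition converges_uniformly_to (S : nat -> set 'rV[R]_r)
    (A : set 'rV[R]_r) : Prop :=
  (forall n, (0 < n)%N -> A `<=` S n) /\
  (forall eps : R, 0 < eps -> exists N : nat,
     forall n, (0 < n)%N -> (N <= n)%N ->
     forall a, S n a -> (dist_to A a < eps%:E)%E).

End Amoebas.

Section Checks.
Variables (R : realType) (r : nat).
Implicit Types (f g : laurent R r) (z u : 'rV[R[i]]_r) (a : 'rV[R]_r)
  (e : 'rV[int]_r).

Lemma normc_monom z e : normc (monom z e) = \prod_(i < r) normc (z 0 i) ^ e 0 i.
Proof.
rewrite /monom (big_morph (@normc R) (@normcM R) (normc1 R)).
apply: eq_bigr => i _.
have normcX x n : normc (x ^+ n) = normc x ^+ n :> R.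
  by elim: n => [|n IH]; rewrite ?expr0 ?normc1 // !exprS normcM IH.
by case: (e 0 i) => n; rewrite ?NegzE -?exprnP -?exprnN ?normcV normcX.
Qed.

Lemma list_at_Log g z : torus z -> list_at g (Log z) = term_norms g z.
Proof.
move=> zT; rewrite /list_at /term_norms; apply: eq_map => e.
rewrite !normcM !normc_monom; congr (_ * _); apply: eq_bigr => i _.
rewrite !mxE; congr (_ ^ _).
have z0 : 0 < normc (z 0 i).
  rewrite lt_def; apply/andP; split; last by case: (z 0 i) => *; exact: sqrtr_ge0.
  by apply: contra (zT i) => /eqP/eq0_normc ->.
by rewrite lnK ?posrE //= expr0n addr0 sqrtr_sqr ger0_norm // ltW.
Qed.

Lemma levalw (D : {fset 'rV[int]_r}) f z : (msupp f `<=` D)%fset ->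
  leval f z = \sum_(e <- D) f@_e * monom z e.
Proof.
move=> le; rewrite /leval (big_fset_incl _ le) //= => e _ /mcoeff_outdom ->.
by rewrite mul0r.
Qed.

Lemma levalD f g z : leval (f + g) z = leval f z + leval g z.
Proof.
rewrite (levalw z (msuppD_le f g)) (levalw z (fsubsetUl (msupp f) (msupp g))).
rewrite (levalw z (fsubsetUr (msupp f) (msupp g))) -big_split /=.
by apply: eq_bigr => e _; rewrite mcoeffD mulrDl.
Qed.

Lemma leval0 z : leval (0 : laurent R r) z = 0.
Proof. by rewrite /leval msupp0 big_seq_fset0. Qed.

Lemma levalU c e z : leval (<< c *g e >> : laurent R r) z = c * monom z e.
Proof. by rewrite (levalw z msuppU_le) big_seq_fset1 mcoeffUU. Qed.

Lemma leval_sum I (s : seq I) (F : I -> laurent R r) z :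
  leval (\sum_(i <- s) F i) z = \sum_(i <- s) leval (F i) z.
Proof.
exact: (big_morph (fun f => leval f z) (fun _ _ => levalD _ _ _) (leval0 z)).
Qed.

Lemma monomD z d e : torus z -> monom z (d + e) = monom z d * monom z e.
Proof.
move=> zT; rewrite /monom -big_split; apply: eq_bigr => i _.
by rewrite mxE expfzDr // zT.
Qed.

Lemma levalM f g z : torus z -> leval (f * g) z = leval f z * leval g z.
Proof.
move=> zT; rewrite [f * g]/(laurent_mul f g) leval_sum.
rewrite [leval f z]/leval [leval g z]/leval mulr_suml.
apply: eq_bigr => d _; rewrite leval_sum mulr_sumr; apply: eq_bigr => e _.
by rewrite levalU monomD // mulrACA.
Qed.

Lemma leval1 z : leval (1 : laurent R r) z = 1.
Proof.
rewrite [1]/(laurent_one R r) levalU mul1r /monom big1 // => i _.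
by rewrite mxE expr0z.
Qed.

Lemma leval_rescale u f z :
  leval (rescale u f) z = leval f (\row_i (u 0 i * z 0 i)).
Proof.
rewrite /rescale leval_sum; apply: eq_bigr => e _.
rewrite levalU -mulrA; congr (_ * _); rewrite /monom -big_split; apply: eq_bigr => i _.
by rewrite mxE expfzMl.
Qed.

Lemma leval_cyclic_prod n f z : torus z ->
  leval (cyclic_prod n f) z =
  \prod_(k : {ffun 'I_r -> 'I_n})
    leval f (\row_i (expi (2 * pi * (k i)%:R / n%:R) * z 0 i)).
Proof.
move=> zT; rewrite (big_morph (fun f => leval f z) (id1 := 1) (op1 := *%R)).
- apply: eq_bigr => k _; rewrite leval_rescale; congr leval.
  by apply/rowP => i; rewrite !mxE.
- by move=> g h; exact: levalM.
- exact: leval1.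
Qed.

End Checks.

(* Main.v *)
(* Let E = exp(delta) and suppose that f has no zero on the set where every
   | log|v_j| - a_j | is at most 2 delta. In one variable,
   prod_l (zeta^l x - y) = +-(x^n - y^n), so the modulus of the product of
   P(zeta^l x) over l is, on an annulus kept away from the roots of P, a constant
   times |x|^(p n) up to a factor ((1 + E^-n)/(1 - E^-n))^(deg P).
   Moving one coordinate at a time, F = cyclic_prod n f satisfies
   |F(v)| <= C (|v_i| / e^(a_i))^(n p_i) |F(z)| near Log^-1(a), with integers
   p_i, a base point z above a, and C -> 1. The Cauchy estimates at
   |v_i| = e^(a_i) E^(+-1) then bound the e-th term of F at z by
   C E^-n |F(z)| unless e_i = n p_i for all i, because only exponents divisible
   by n occur in F. The number of terms is polynomial in n and their absolute
   values add up to at least |F(z)|, so the remaining term dominates. All bounds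
   depend on a only through delta, whence the uniformity. *)

Require Import Defs.
From mathcomp Require Import all_boot all_order all_algebra.
From mathcomp Require Import finmap monalg.
From mathcomp Require Import all_classical all_reals all_analysis.
From mathcomp Require Import complex ring lra zify.

Set Implicit Arguments.
Unset Strict Implicit.
Unset Printing Implicit Defensive.

Import Order.TTheory GRing.Theory Num.Theory.
Import ComplexField.Normc.

Local Open Scope ring_scope.
Local Open Scope complex_scope.

(** * Moduli of complex numbers *)

Lemma normc_ge0 (R : rcfType) (x : R[i]) : 0 <= normc x.
Proof. by case: x => a b /=; rewrite sqrtr_ge0. Qed.

Lemma normc_eq0 (R : rcfType) (x : R[i]) : (normc x == 0) = (x == 0).
Proof. by apply/eqP/eqP => [/eq0_normc|->]; rewrite ?normc0. Qed.

Lemma normc_gt0 (R : rcfType) (x : R[i]) : (0 < normc x) = (x != 0).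
Proof. by rewrite lt_def normc_ge0 normc_eq0 andbT. Qed.

Lemma normcX (R : rcfType) (x : R[i]) n : normc (x ^+ n) = normc x ^+ n.
Proof. by elim: n => [|n IH]; rewrite ?expr0 ?normc1 // !exprS normcM IH. Qed.

Lemma normc_exprz (R : rcfType) (x : R[i]) (m : int) :
  normc (x ^ m) = normc x ^ m.
Proof.
case: (intP m) => [|n|n]; rewrite ?expr0z ?normc1 //.
  by rewrite -!exprnP normcX.
by rewrite -!exprnN normcV normcX.
Qed.

Lemma normcB (R : rcfType) (x y : R[i]) : normc (x - y) = normc (y - x).
Proof. by rewrite -(opprB y x); exact: normcN. Qed.

Lemma normc_nat (R : rcfType) n : normc (n%:R : R[i]) = n%:R.
Proof. by rewrite (normcMn (1 : Rcomplex R)) normc1. Qed.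

Lemma normc_real (R : rcfType) (x : R) : 0 <= x -> normc x%:C = x.
Proof. by move=> x0; rewrite /normc /= expr0n addr0 sqrtr_sqr ger0_norm. Qed.

Lemma le_normc_add (R : rcfType) (x y : R[i]) :
  normc (x + y) <= normc x + normc y.
Proof. exact: (le_normcD (x : Rcomplex R) y). Qed.

Lemma le_normc_sub (R : rcfType) (x y : R[i]) :
  normc (x - y) <= normc x + normc y.
Proof. by rewrite -(normcN y); exact: le_normc_add. Qed.

Lemma ge_normc_sub (R : rcfType) (x y : R[i]) :
  normc x - normc y <= normc (x - y).
Proof. by rewrite lerBlDr -{1}(subrK y x) le_normc_add. Qed.

Lemma normc_prod (R : rcfType) I (s : seq I) (P : pred I) (F : I -> R[i]) :
  normc (\prod_(i <- s | P i) F i) = \prod_(i <- s | P i) normc (F i).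
Proof. exact: (big_morph (@normc R) (@normcM R) (normc1 R)). Qed.

Lemma le_normc_sum (R : rcfType) I (s : seq I) (P : pred I) (F : I -> R[i]) :
  normc (\sum_(i <- s | P i) F i) <= \sum_(i <- s | P i) normc (F i).
Proof.
elim/big_ind2: _ => [||//]; first by rewrite normc0.
by move=> x y z t xy zt; rewrite (le_trans (le_normc_add _ _)) ?lerD.
Qed.

(** * Roots of unity *)

Lemma expiD (R : realType) (x y : R) : expi (x + y) = expi x * expi y.
Proof.
by apply/eqP; rewrite eq_complex /= cosD sinD eqxx [X in _ == X]addrC eqxx.
Qed.

Lemma expi_mulrn (R : realType) (x : R) n : expi (x *+ n) = expi x ^+ n.
Proof.
elim: n => [|n IH]; first by rewrite mulr0n expr0 /expi cos0 sin0.
by rewrite mulrS exprS expiD IH.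
Qed.

Lemma normc_expi (R : realType) (x : R) : normc (expi x) = 1.
Proof. by rewrite /normc /expi cos2Dsin2 sqrtr1. Qed.

Definition zeta (R : realType) n : R[i] := expi (2 * pi / n%:R).

Lemma expi_zeta (R : realType) n k :
  expi (2 * pi * k%:R / n%:R) = zeta R n ^+ k.
Proof. by rewrite /zeta -expi_mulrn; congr expi; rewrite mulrAC mulr_natr. Qed.

Lemma normc_zetaX (R : realType) n k : normc (zeta R n ^+ k) = 1.
Proof. by rewrite normcX normc_expi expr1n. Qed.

Lemma zetaX_neq0 (R : realType) n k : zeta R n ^+ k != 0.
Proof. by rewrite -normc_gt0 normc_zetaX. Qed.

(** If the order m of [zeta R n] were less than n, then cos(2 pi m / n) = 1 would force sin(pi m /
    n) = 0, although pi m / n lies strictly between 0 and pi. *)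
Lemma prim_zeta (R : realType) n : (0 < n)%N -> n.-primitive_root (zeta R n).
Proof.
move=> n0; have nR : n%:R != 0 :> R by rewrite pnatr_eq0 -lt0n.
have zn : zeta R n ^+ n = 1.
  rewrite -expi_zeta mulfK // mulr_natl /expi cos2pi.
  by rewrite sin_mulr2n sinpi mulr0 mul0rn.
have [m pm mn] := prim_order_exists n0 zn.
have [mn_eq|mNn] := eqVneq m n; first by rewrite -{1}mn_eq.
have m0 := prim_order_gt0 pm.
have ltmn : (m < n)%N by rewrite ltn_neqAle mNn dvdn_leq.
have := prim_expr_order pm; rewrite -expi_zeta => -[+ _].
have -> : 2 * pi * m%:R / n%:R = (pi * m%:R / n%:R) *+ 2 :> R.
  by rewrite -mulr_natr; ring.
have s0 : 0 < sin (pi * m%:R / n%:R : R).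
  apply: sin_gt0_pi; rewrite divr_gt0 ?mulr_gt0 ?pi_gt0 ?ltr0n //=.
  by rewrite ltr_pdivrMr ?ltr0n // ltr_pM2l ?pi_gt0 // ltr_nat.
rewrite cos_mulr2n; have := cos2Dsin2 (pi * m%:R / n%:R : R).
by have := exprn_gt0 2 s0; lra.
Qed.

(** * Cyclic products of polynomials in one variable *)

(** For x nonzero this is the factorization of X^n - 1 evaluated at y / x and multiplied by x^n. *)
Lemma prod_subr_prim_root (F : fieldType) n (z x y : F) :
  n.-primitive_root z -> \prod_(l < n) (y - z ^+ l * x) = y ^+ n - x ^+ n.
Proof.
move=> pz; have [->|x0] := eqVneq x 0.
  rewrite expr0n eqn0Ngt (prim_order_gt0 pz) subr0.
  by under eq_bigr do rewrite mulr0 subr0; rewrite prodr_const card_ord.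
transitivity (\prod_(l < n) (x * (y / x - z ^+ l))).
  by apply: eq_bigr => l _; rewrite mulrBr mulrCA divff // mulr1 mulrC.
have /(congr1 (horner^~ (y / x))) := factor_Xn_sub_1 pz.
rewrite horner_prod big_mkord hornerD hornerN hornerXn hornerC expr_div_n => H.
rewrite big_split /= prodr_const card_ord.
under [in LHS]eq_bigr => l _ do rewrite -(hornerXsubC (z ^+ l)).
by rewrite H mulrBr mulr1 mulrCA divff ?mulr1 ?expf_neq0.
Qed.

(* Varying x inside an annulus that keeps away from the circle |x| = |y|
   changes |x^n - y^n| only by a power of |x| and a factor close to 1. *)
Lemma subX_ratio (R : rcfType) n (eta : R) (x w y : R[i]) (inner : bool) :
  0 <= eta -> eta < 1 -> x != 0 -> w != 0 ->
  (forall v, v = x \/ v = w ->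
    if inner then normc y ^+ n <= eta * normc v ^+ n
    else normc v ^+ n <= eta * normc y ^+ n) ->
  normc (x ^+ n - y ^+ n) <=
  (1 + eta) / (1 - eta) * ((normc x / normc w) ^+ n) ^+ inner *
  normc (w ^+ n - y ^+ n).
Proof.
move=> h0 h1 x0 w0 H.
have nx0 : 0 < normc x by rewrite normc_gt0.
have nw0 : 0 < normc w by rewrite normc_gt0.
have eta1 : 0 < 1 - eta by lra.
rewrite -mulrA mulrAC ler_pdivlMr //.
have Hx := H x (or_introl erefl); have Hw := H w (or_intror erefl).
have ux := le_normc_sub (x ^+ n) (y ^+ n).
have lw := ge_normc_sub (w ^+ n) (y ^+ n).
have lw' := ge_normc_sub (y ^+ n) (w ^+ n).
rewrite normcB in lw'; rewrite !normcX in ux lw lw'.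
case: inner {H} Hx Hw => Hx Hw.
  rewrite expr1 expr_div_n; set X := normc x ^+ n; set W := normc w ^+ n.
  have W0 : 0 < W by rewrite exprn_gt0.
  have X0 : 0 < X by rewrite exprn_gt0.
  rewrite -/X -/W in ux lw lw' Hx Hw.
  apply: (@le_trans _ _ ((1 + eta) * X * (1 - eta))).
    by rewrite ler_wpM2r; [| lra | lra].
  have -> : (1 + eta) * (X / W * normc (w ^+ n - y ^+ n)) =
            (1 + eta) * X * (normc (w ^+ n - y ^+ n) / W) by ring.
  rewrite ler_wpM2l //; first by rewrite mulr_ge0 //; lra.
  by rewrite ler_pdivlMr //; lra.
rewrite expr0 mul1r.
set Y := normc y ^+ n; set X := normc x ^+ n; set W := normc w ^+ n.
rewrite -/X -/W -/Y in ux lw lw' Hx Hw.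
have Y0 : 0 <= Y by rewrite exprn_ge0 ?normc_ge0.
apply: (@le_trans _ _ ((1 + eta) * Y * (1 - eta))).
  by rewrite ler_wpM2r; [| lra | lra].
by rewrite -mulrA ler_wpM2l; [| lra | lra].
Qed.

(** The constant of [subX_ratio] for eta = E^-n. For E > 1 it tends to 1 as n grows. *)
Definition distortion (R : realFieldType) (E : R) n : R :=
  (1 + E ^- n) / (1 - E ^- n).

Lemma exprVn_lt1 (R : realFieldType) (E : R) n :
  1 < E -> (0 < n)%N -> E ^- n < 1.
Proof.
move=> E1 n0; have E0 := lt_trans ltr01 E1.
by rewrite invf_lt1 ?exprn_gt0 // exprn_egt1 // -lt0n.
Qed.

Lemma distortion_ge1 (R : realFieldType) (E : R) n :
  1 < E -> (0 < n)%N -> 1 <= distortion E n.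
Proof.
move=> E1 n0; have E0 := ltW (lt_trans ltr01 E1).
have eta0 : 0 <= E ^- n by rewrite invr_ge0 exprn_ge0.
have eta1 := exprVn_lt1 E1 n0.
by rewrite /distortion ler_pdivlMr; lra.
Qed.

(* The exponent p counts the roots in the disc that the annulus surrounds. *)
Lemma poly_cyclic_ratio (R : realType) n (P : {poly R[i]}) (rho E : R) :
  (0 < n)%N -> 0 < rho -> 1 < E ->
  (forall v, rho / E ^+ 2 <= normc v <= rho * E ^+ 2 -> ~~ root P v) ->
  exists p : nat, forall x w,
    rho / E <= normc x <= rho * E -> rho / E <= normc w <= rho * E ->
    normc (\prod_(l < n) P.[zeta R n ^+ l * x]) <=
    distortion E n ^+ (size P).-1 *
    ((normc x / normc w) ^+ n) ^+ p *
    normc (\prod_(l < n) P.[zeta R n ^+ l * w]).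
Proof.
move=> n0 rho0 E1 Proot; have E0 : 0 < E by lra.
have eta0 : 0 <= E ^- n by rewrite invr_ge0 exprn_ge0 // ltW.
have eta1 := exprVn_lt1 E1 n0.
set eta := E ^- n in eta0 eta1; set K := distortion E n.
(* The zero polynomial would have the root [rho], which lies in the annulus. *)
have P0 : P != 0.
  apply/eqP => P0; have := Proot rho%:C.
  rewrite P0 root0 normc_real ?(ltW rho0) //=.
  have E2 : 1 <= E ^+ 2 by rewrite exprn_ege1 // ltW.
  rewrite ler_pdivrMr ?exprn_gt0 // ler_peMr ?ler_peMr // ?(ltW rho0) //.
  by move=> /(_ isT).
have [s Ps] := closed_field_poly_normal P.
have cP : lead_coef P != 0 by rewrite lead_coef_eq0.
have sP : (size P).-1 = size s.
  by rewrite Ps size_scale // size_prod_XsubC.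
have prodP x : normc (\prod_(l < n) P.[zeta R n ^+ l * x]) =
    normc (lead_coef P) ^+ n * \prod_(y <- s) normc (x ^+ n - y ^+ n).
  rewrite normc_prod.
  transitivity (\prod_(l < n) (normc (lead_coef P) *
     \prod_(y <- s) normc (y - zeta R n ^+ l * x))).
    apply: eq_bigr => l _; rewrite {1}Ps hornerZ horner_prod normcM normc_prod.
    by congr (_ * _); apply: eq_bigr => y _; rewrite hornerXsubC normcB.
  rewrite big_split /= prodr_const card_ord exchange_big /=; congr (_ * _).
  apply: eq_bigr => y _; rewrite normcB.
  by rewrite -(prod_subr_prim_root x y (prim_zeta R n0)) normc_prod.
have sroot y : y \in s -> (normc y < rho / E ^+ 2) || (rho * E ^+ 2 < normc y).
  move=> ys; apply: contraT; rewrite negb_or -!leNgt => /andP[h1 h2].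
  have := Proot y; rewrite h1 h2 => /(_ isT) /negP[].
  by rewrite Ps rootZ // root_prod_XsubC.
have factor_le x w y : y \in s ->
    rho / E <= normc x <= rho * E -> rho / E <= normc w <= rho * E ->
    normc (x ^+ n - y ^+ n) <=
    K * ((normc x / normc w) ^+ n) ^+ (normc y < rho)%R *
    normc (w ^+ n - y ^+ n).
  move=> ys xE wE; have rE : 0 < rho / E by rewrite divr_gt0.
  rewrite /K /distortion -/eta; apply: subX_ratio => //.
  - by rewrite -normc_gt0; case/andP: xE => + _; apply: lt_le_trans.
  - by rewrite -normc_gt0; case/andP: wE => + _; apply: lt_le_trans.
  move=> v vxw; have {xE wE vxw} /andP[v1 v2] : rho / E <= normc v <= rho * E.
    by case: vxw => ->.
  (* Roots avoid the annulus of ratio [E ^+ 2] while [v] stays in that of ratio [E]. So the moduli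
     of [v] and [y] differ by a factor of at least [E], and their n-th powers by at least [E ^+ n],
     the inverse of [eta]. *)
  have pE (a b : R) : 0 <= a -> a * E <= b -> a ^+ n <= eta * b ^+ n.
    move=> a0 ab; rewrite mulrC ler_pdivlMr ?exprn_gt0 // -exprMn.
    have aE0 : 0 <= a * E by rewrite mulr_ge0 // ltW.
    by rewrite lerXn2r // nnegrE // (le_trans aE0 ab).
  case/orP: (sroot y ys) => hy.
    have -> : normc y < rho.
      apply: (lt_trans hy); rewrite ltr_pdivrMr ?exprn_gt0 // ltr_pMr //.
      by rewrite exprn_egt1.
    apply: pE; first exact: normc_ge0.
    apply: le_trans v1; rewrite ler_pdivlMr // -mulrA -expr2.
    by rewrite -ler_pdivlMr ?exprn_gt0 // ltW.
  have -> : normc y < rho = false.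
    apply/negbTE; rewrite -leNgt; apply: le_trans (ltW hy).
    by rewrite ler_peMr ?(ltW rho0) // exprn_ege1 // ltW.
  apply: pE; first exact: normc_ge0.
  by apply: le_trans (ltW hy); rewrite expr2 mulrA ler_wpM2r // ltW.
exists (count (fun y => normc y < rho) s) => x w xE wE.
rewrite !prodP sP [leRHS]mulrCA ler_wpM2l ?exprn_ge0 ?normc_ge0 //.
elim: s {Ps sP prodP sroot} factor_le => [|y s IH] fl /=.
  by rewrite !big_nil !expr0 !mulr1.
rewrite !big_cons exprS exprD.
have := fl x w y (mem_head _ _) xE wE.
have {}IH : \prod_(z <- s) normc (x ^+ n - z ^+ n) <= K ^+ size s *
    ((normc x / normc w) ^+ n) ^+ count (fun z => (normc z < rho)%R) s *
    \prod_(z <- s) normc (w ^+ n - z ^+ n).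
  by apply: IH => x' w' z zs; apply: fl; rewrite inE zs orbT.
move=> h; apply: (le_trans (ler_pM _ _ h IH)); rewrite ?normc_ge0 //.
  by apply: prodr_ge0 => z _; rewrite normc_ge0.
by rewrite mulrACA [X in X * _ <= _]mulrACA.
Qed.

(** * Laurent polynomials in one coordinate *)

Definition updc (T : Type) (r : nat) (z : 'rV[T]_r) (i : 'I_r) (x : T) :
  'rV[T]_r :=
  \row_j (if j == i then x else z 0 j).

Lemma updcE (T : Type) (r : nat) (z : 'rV[T]_r) i x : updc z i x 0 i = x.
Proof. by rewrite mxE eqxx. Qed.

Lemma updcNE (T : Type) (r : nat) (z : 'rV[T]_r) i x j :
  j != i -> updc z i x 0 j = z 0 j.
Proof. by rewrite mxE => /negbTE->. Qed.

Lemma updc_id (T : Type) (r : nat) (z : 'rV[T]_r) i : updc z i (z 0 i) = z.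
Proof. by apply/rowP => j; rewrite mxE; case: eqP => [->|]. Qed.

Definition degree_le (R : realType) (r D : nat) (f : laurent R r) : Prop :=
  forall e, e \in msupp f -> forall i, `|e 0 i| <= D%:Z.

Lemma monom_updc (R : realType) (r : nat) (z : 'rV[R[i]]_r) i x e :
  monom (updc z i x) e = x ^ e 0 i * \prod_(j < r | j != i) z 0 j ^ e 0 j.
Proof.
rewrite /monom; etransitivity; first by apply: (bigD1 i).
apply: congr2; first by rewrite updcE.
by apply: eq_bigr => j ji; rewrite mxE (negbTE ji).
Qed.

(** The factor x^D clears the negative exponents: all e_i + D lie between 0 and 2 D. *)
Lemma leval_updc_poly (R : realType) (r : nat) (f : laurent R r) D z i :
  degree_le D f -> exists2 P : {poly R[i]}, (size P <= (2 * D).+1)%N &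
    forall x, x != 0 -> P.[x] = leval f (updc z i x) * x ^+ D.
Proof.
move=> fD; exists (\sum_(e <- msupp f)
  (f@_e * \prod_(j < r | j != i) z 0 j ^ e 0 j) *: 'X^(`|e 0 i + D%:Z|)).
  rewrite big_seq_cond; apply: (leq_trans (size_sum _ _ _)).
  apply/bigmax_leqP_seq => e _; rewrite andbT => ef.
  apply: leq_trans (size_scale_leq _ _) _; rewrite size_polyXn ltnS.
  by have := fD e ef i; lia.
move=> x x0; rewrite /leval mulr_suml horner_sum big_seq [RHS]big_seq.
apply: eq_bigr => e ef; rewrite hornerZ hornerXn monom_updc -!mulrA.
congr (_ * _); rewrite [RHS]mulrCA; congr (_ * _).
rewrite !exprnP -expfzDr //; congr (x ^ _).
rewrite gez0_abs // -lerBlDr sub0r.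
by have := fD e ef i; rewrite ler_norml => /andP[].
Qed.

(** [poly_cyclic_ratio] applies to the polynomial with cleared denominators. The clearing factors
    contribute |x|^(n D) to the product over l, so the exponent drops by D and may become
    negative. *)
Lemma leval_cyclic_ratio (R : realType) (r n D : nat) (f : laurent R r)
    (rho E : R) z i :
  (0 < n)%N -> 0 < rho -> 1 < E -> degree_le D f ->
  (forall v, rho / E ^+ 2 <= normc v <= rho * E ^+ 2 ->
    leval f (updc z i v) != 0) ->
  exists p : int, forall x w,
    rho / E <= normc x <= rho * E -> rho / E <= normc w <= rho * E ->
    normc (\prod_(l < n) leval f (updc z i (zeta R n ^+ l * x))) <=
    distortion E n ^+ (2 * D) *
    ((normc x / normc w) ^+ n) ^ p *
    normc (\prod_(l < n) leval f (updc z i (zeta R n ^+ l * w))).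
Proof.
move=> n0 rho0 E1 fD f0; have E0 : 0 < E by lra.
have [P sP PE] := leval_updc_poly z i fD.
have [v|p pP] := @poly_cyclic_ratio R n P rho E n0 rho0 E1.
  move=> vE; have v0 : v != 0.
    rewrite -normc_gt0; case/andP: vE => + _; apply: lt_le_trans.
    by rewrite divr_gt0 ?exprn_gt0.
  by rewrite /root PE // mulf_neq0 ?expf_neq0 ?f0.
exists (p%:Z - D%:Z) => x w xE wE.
have gt0 v : rho / E <= normc v <= rho * E -> 0 < normc v.
  by case/andP => + _; apply: lt_le_trans; rewrite divr_gt0.
have x0 := gt0 x xE; have w0 := gt0 w wE.
have prodE v : 0 < normc v -> normc (\prod_(l < n) P.[zeta R n ^+ l * v]) =
    normc (\prod_(l < n) leval f (updc z i (zeta R n ^+ l * v))) *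
    (normc v ^+ n) ^+ D.
  rewrite normc_gt0 => v0; rewrite -exprM mulnC exprM.
  rewrite -[X in _ ^+ X]card_ord -prodr_const !normc_prod -big_split /=.
  apply: eq_bigr => l _; rewrite PE ?mulf_neq0 ?zetaX_neq0 //.
  by rewrite normcM normcX normcM normc_zetaX mul1r.
have := pP x w xE wE; rewrite !prodE // => le.
have X0 : 0 < normc x ^+ n by rewrite exprn_gt0.
have W0 : 0 < normc w ^+ n by rewrite exprn_gt0.
rewrite -ler_pdivlMr ?exprn_gt0 // in le; apply: (le_trans le).
have q0 : 0 < (normc x / normc w) ^+ n by rewrite exprn_gt0 ?divr_gt0.
have qE : (normc x / normc w) ^+ n = normc x ^+ n / normc w ^+ n.
  exact: expr_div_n.
rewrite expfzDr ?gt_eqF // -exprnN -exprnP.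
have -> : (normc x / normc w) ^+ n ^- D =
   (normc w ^+ n) ^+ D / (normc x ^+ n) ^+ D.
  by rewrite qE expr_div_n invf_div.
set A := normc (\prod_(l < n) _); set q := (_ / _) ^+ n ^+ p.
set a := _ ^+ D; set b := _ ^+ D.
have -> : forall K, K * q * (A * a) / b = K * (q * (a / b)) * A.
  by move=> K; ring.
have qab0 : 0 <= q * (a / b).
  by apply: mulr_ge0; [|apply: divr_ge0]; apply/exprn_ge0/ltW.
rewrite ler_wpM2r ?normc_ge0 // ler_wpM2r //.
(* As [distortion E n] is at least 1, its exponent may be raised from the degree of [P] to
   [2 * D]. *)
rewrite ler_weXn2l ?distortion_ge1 //.
by case: (size P) sP.
Qed.

(** * Growth of the cyclic product near a torus *)

Definition updf (r n : nat) (k : {ffun 'I_r -> 'I_n}) (i : 'I_r) (l : 'I_n) :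
  {ffun 'I_r -> 'I_n} := [ffun j => if j == i then l else k j].

(** The action of r-tuples of n-th roots of unity; the cyclic product multiplies the values of f
    along an orbit. *)
Definition rotate (R : realType) (r n : nat) (k : {ffun 'I_r -> 'I_n})
    (z : 'rV[R[i]]_r) : 'rV[R[i]]_r :=
  \row_j (zeta R n ^+ k j * z 0 j).

Lemma leval_cyclic_prodE (R : realType) (r n : nat) (f : laurent R r) z :
  torus z ->
  leval (cyclic_prod n f) z =
  \prod_(k : {ffun 'I_r -> 'I_n}) leval f (rotate k z).
Proof.
move=> zT; rewrite (leval_cyclic_prod n f zT).
apply: eq_bigr => k _; congr leval.
by apply/rowP => j; rewrite !mxE expi_zeta.
Qed.

(** Tuples are grouped by their entries away from i. The value [o] at i only serves to pick one
    representative of each group. *)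
Lemma prod_ffun_split (A : comNzRingType) (r n : nat)
    (F : {ffun 'I_r -> 'I_n} -> A) (i : 'I_r) (o : 'I_n) :
  \prod_k F k =
  \prod_(k : {ffun _ -> _} | k i == o) \prod_(l < n) F (updf k i l).
Proof.
rewrite exchange_big (partition_big (fun k : {ffun _ -> _} => k i) predT) //=.
apply: eq_bigr => l _.
rewrite (reindex_onto (fun k => updf k i l) (fun k => updf k i o)) /=;
  last first.
  move=> k /eqP kl; apply/ffunP => j; rewrite !ffunE.
  by case: eqP => [->|//]; rewrite kl.
apply: eq_bigl => k; rewrite ffunE !eqxx /=.
apply/eqP/eqP => [/ffunP/(_ i)|ko]; first by rewrite !ffunE eqxx.
by apply/ffunP => j; rewrite !ffunE; case: eqP => [->|//]; rewrite ko.
Qed.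

(** Once the rotations of the other coordinates are fixed, what remains is a product over l of the
    form that [leval_cyclic_ratio] bounds. *)
Lemma normc_cyclic_prod_updc (R : realType) (r n : nat) (f : laurent R r) z
    (i : 'I_r) (o : 'I_n) x : torus (updc z i x) ->
  normc (leval (cyclic_prod n f) (updc z i x)) =
  \prod_(k : {ffun 'I_r -> 'I_n} | k i == o)
    normc (\prod_(l < n) leval f (updc (rotate k z) i (zeta R n ^+ l * x))).
Proof.
move=> zT; rewrite leval_cyclic_prodE //.
rewrite (prod_ffun_split _ i o) normc_prod; apply: eq_bigr => k _.
congr normc; apply: eq_bigr => l _; congr leval; apply/rowP => j.
by rewrite !mxE ffunE; case: eqP.
Qed.

(** In logarithmic coordinates this is the cube of half-side [ln E] about the point with coordinates
    [ln (rho 0 j)]. *)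
Definition near_torus (R : realType) (r : nat) (rho : 'rV[R]_r) (E : R)
    (v : 'rV[R[i]]_r) : Prop :=
  forall j, rho 0 j / E <= normc (v 0 j) <= rho 0 j * E.

Lemma near_torus_torus (R : realType) (r : nat) (rho : 'rV[R]_r) E v :
  (forall j, 0 < rho 0 j) -> 0 < E -> near_torus rho E v -> torus v.
Proof.
move=> rho0 E0 vE j; rewrite -normc_gt0; case/andP: (vE j) => + _.
by apply: lt_le_trans; rewrite divr_gt0.
Qed.

Lemma near_torus_updc (R : realType) (r : nat) (rho : 'rV[R]_r) E v i x :
  near_torus rho E v -> rho 0 i / E <= normc x <= rho 0 i * E ->
  near_torus rho E (updc v i x).
Proof. by move=> vE xE j; rewrite mxE; case: eqP => [->|]. Qed.

Lemma near_torus_sqr (R : realType) (r : nat) (rho : 'rV[R]_r) E v :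
  (forall j, 0 < rho 0 j) -> 1 < E -> near_torus rho E v ->
  near_torus rho (E ^+ 2) v.
Proof.
move=> rho0 E1 vE j; have E0 := lt_trans ltr01 E1; case/andP: (vE j) => v1 v2.
rewrite (le_trans _ v1) ?(le_trans v2) //.
  by rewrite ler_pM2l // expr2 ler_peMr // ltW.
by rewrite ler_pM2l // expr2 invfM ler_piMr ?invr_ge0 ?invf_le1 // ltW.
Qed.

Lemma near_torus_rotate (R : realType) (r n : nat) (k : {ffun 'I_r -> 'I_n})
    (rho : 'rV[R]_r) E z :
  near_torus rho E z -> near_torus rho E (rotate k z).
Proof. by move=> zE j; rewrite mxE normcM normc_zetaX mul1r. Qed.

Lemma prod_exprz (F : fieldType) (I : finType) (P : pred I) (q : F)
    (p : I -> int) :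
  q != 0 -> \prod_(k | P k) q ^ p k = q ^ (\sum_(k | P k) p k).
Proof.
move=> q0; apply: esym.
by apply: (big_morph (fun m : int => q ^ m)) => // a b; rewrite expfzDr.
Qed.

(** One factor [distortion E n ^+ (2 * D)] for each one-variable product; there are n^(r-1) of
    these, counted crudely as n^r. *)
Definition cyclic_distortion (R : realType) (r D n : nat) (E : R) : R :=
  distortion E n ^+ (2 * D * n ^ r).

Lemma cyclic_distortion_ge1 (R : realType) (r D n : nat) (E : R) :
  1 < E -> (0 < n)%N -> 1 <= cyclic_distortion r D n E.
Proof. by move=> E1 n0; rewrite exprn_ege1 ?distortion_ge1. Qed.

(** The bounds of [leval_cyclic_ratio] at all rotations of z are multiplied, so their exponents add
    up to p. Rotations preserve moduli, hence f has no zero on any of the annuli involved. *)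
Lemma cyclic_prod_updc_le (R : realType) (r n D : nat) (f : laurent R r)
    (rho : 'rV[R]_r) (E : R) z i :
  (0 < n)%N -> (forall j, 0 < rho 0 j) -> 1 < E -> degree_le D f ->
  (forall v, near_torus rho (E ^+ 2) v -> leval f v != 0) ->
  near_torus rho E z ->
  exists p : int, forall x w,
    rho 0 i / E <= normc x <= rho 0 i * E ->
    rho 0 i / E <= normc w <= rho 0 i * E ->
    normc (leval (cyclic_prod n f) (updc z i x)) <=
    cyclic_distortion r D n E * ((normc x / normc w) ^+ n) ^ p *
    normc (leval (cyclic_prod n f) (updc z i w)).
Proof.
move=> n0 rho0 E1 fD f0 zE; have E0 := lt_trans ltr01 E1.
have /choice[p pP] (k : {ffun 'I_r -> 'I_n}) :=
  leval_cyclic_ratio n0 (rho0 i) E1 fD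
  (fun v vE => f0 _ (near_torus_updc
    (near_torus_sqr rho0 E1 (near_torus_rotate k zE)) vE)).
exists (\sum_(k : {ffun 'I_r -> 'I_n} | k i == Ordinal n0) p k) => x w xE wE.
have xT := near_torus_torus rho0 E0 (near_torus_updc zE xE).
have wT := near_torus_torus rho0 E0 (near_torus_updc zE wE).
have K1 := distortion_ge1 E1 n0.
have gt0 v : rho 0 i / E <= normc v <= rho 0 i * E -> 0 < normc v.
  by case/andP => + _; apply: lt_le_trans; rewrite divr_gt0.
have q0 : 0 < (normc x / normc w) ^+ n by rewrite exprn_gt0 ?divr_gt0 ?gt0.
rewrite !(normc_cyclic_prod_updc f (Ordinal n0)) //.
have le k : 0 <= normc (\prod_(l < n)
      leval f (updc (rotate k z) i (zeta R n ^+ l * x))) <=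
    distortion E n ^+ (2 * D) * ((normc x / normc w) ^+ n) ^ p k *
    normc (\prod_(l < n) leval f (updc (rotate k z) i (zeta R n ^+ l * w))).
  by rewrite normc_ge0 pP.
apply: le_trans; first by apply: ler_prod => k _; exact: le k.
rewrite !big_split /= prod_exprz ?gt_eqF //.
rewrite ler_wpM2r ?prodr_ge0 => // [k _|]; first exact: normc_ge0.
rewrite ler_wpM2r ?exprz_ge0 ?(ltW q0) //.
rewrite prodr_const -exprM ler_weXn2l // leq_mul2l; apply/orP; right.
by rewrite (leq_trans (max_card _)) // card_ffun !card_ord.
Qed.

(** The coordinates of w are replaced by those of v one at a time. The moduli agree, so the power in
    [cyclic_prod_updc_le] is 1 and each replacement costs only one factor [cyclic_distortion]. *)
Lemma cyclic_prod_arg_le (R : realType) (r n D : nat) (f : laurent R r)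
    (rho : 'rV[R]_r) (E : R) (v w : 'rV[R[i]]_r) :
  (0 < n)%N -> (forall j, 0 < rho 0 j) -> 1 < E -> degree_le D f ->
  (forall v, near_torus rho (E ^+ 2) v -> leval f v != 0) ->
  near_torus rho E w -> (forall j, normc (v 0 j) = normc (w 0 j)) ->
  normc (leval (cyclic_prod n f) v) <=
  cyclic_distortion r D n E ^+ r * normc (leval (cyclic_prod n f) w).
Proof.
move=> n0 rho0 E1 fD f0 wE vw.
pose h m : 'rV[R[i]]_r := \row_j (if (j < m)%N then v 0 j else w 0 j).
have hE m : near_torus rho E (h m).
  by move=> j; rewrite mxE; case: ifP; rewrite ?vw.
have le m : (m <= r)%N -> normc (leval (cyclic_prod n f) (h m)) <=
    cyclic_distortion r D n E ^+ m * normc (leval (cyclic_prod n f) (h 0)).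
  elim: m => [|m IH] mr; first by rewrite mul1r.
  pose i := Ordinal mr.
  have [p] := cyclic_prod_updc_le i n0 rho0 E1 fD f0 (hE m).
  have wiE := wE i; have viE := wE i; rewrite -vw in viE.
  move=> /(_ _ _ viE wiE); rewrite vw divff; last first.
    by rewrite normc_eq0 (near_torus_torus rho0 (lt_trans ltr01 E1) wE).
  rewrite expr1n exp1rz mulr1.
  have -> : updc (h m) i (v 0 i) = h m.+1.
    apply/rowP => j; rewrite !mxE; have [->|ji] := eqVneq j i.
      by rewrite ltnSn.
    have -> : (j < m.+1)%N = (j < m)%N by move: ji; rewrite -val_eqE /=; lia.
    by [].

  have -> : updc (h m) i (w 0 i) = h m.
    by rewrite -[RHS](updc_id _ i) mxE ltnn.
  move=> /le_trans; apply; rewrite exprS -mulrA ler_wpM2l ?IH ?(ltnW mr) //.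
  by rewrite (le_trans ler01) // cyclic_distortion_ge1.
have -> : v = h r by apply/rowP => j; rewrite mxE ltn_ord.
have {1}-> : w = h 0%N by apply/rowP => j; rewrite mxE.
exact: le.
Qed.

(** The point v is first replaced by z with i-th coordinate v_i, which has the same moduli and costs
    r factors; then coordinate i moves back to z_i at the cost of one more. The exponent comes from
    z alone, so it serves every v. *)
Lemma cyclic_prod_torus_le (R : realType) (r n D : nat) (f : laurent R r)
    (rho : 'rV[R]_r) (E : R) (z : 'rV[R[i]]_r) i :
  (0 < n)%N -> (forall j, 0 < rho 0 j) -> 1 < E -> degree_le D f ->
  (forall v, near_torus rho (E ^+ 2) v -> leval f v != 0) ->
  (forall j, normc (z 0 j) = rho 0 j) ->
  exists p : int, forall v, near_torus rho E v ->
    (forall j, j != i -> normc (v 0 j) = rho 0 j) ->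
    normc (leval (cyclic_prod n f) v) <=
    cyclic_distortion r D n E ^+ r.+1 *
    ((normc (v 0 i) / rho 0 i) ^+ n) ^ p * normc (leval (cyclic_prod n f) z).
Proof.
move=> n0 rho0 E1 fD f0 zrho; have E0 := lt_trans ltr01 E1.
have rhoE j : rho 0 j / E <= rho 0 j <= rho 0 j * E.
  by rewrite ler_pdivrMr // !ler_peMr // ltW.
have zE : near_torus rho E z by move=> j; rewrite zrho.
have [p pP] := cyclic_prod_updc_le i n0 rho0 E1 fD f0 zE.
exists p => v vE vrho.
have uE := near_torus_updc zE (vE i).
apply: (le_trans (cyclic_prod_arg_le n0 rho0 E1 fD f0 uE _)) => [j|].
  by rewrite mxE; case: eqP => [->//|/eqP ji]; rewrite vrho // zrho.
have C0 := le_trans ler01 (cyclic_distortion_ge1 r D E1 n0).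
rewrite exprSr -!mulrA ler_wpM2l ?(exprn_ge0 r C0) //.
rewrite mulrA; have := pP (v 0 i) (z 0 i) (vE i).
by rewrite updc_id zrho; apply.
Qed.

(** * Fourier inversion, Cauchy estimates, divisibility of exponents *)

Lemma exprz_absz_eq1 (F : fieldType) (x : F) (m : int) :
  x ^ m = 1 -> x ^+ `|m|%N = 1.
Proof.
case: (intP m) => // n; rewrite -exprnN abszN => /(congr1 GRing.inv).
by rewrite invrK invr1.
Qed.

(** A geometric sum: for nonzero m with |m| < N the ratio zeta^m is an N-th root of unity other than
    1. *)
Lemma sum_zeta_exprz (R : realType) N (m : int) : (0 < N)%N -> `|m| < N%:Z ->
  \sum_(l < N) (zeta R N ^+ l) ^ m = if m == 0 then N%:R else 0.
Proof.
move=> N0 mN; have pz := prim_zeta R N0.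
have [->|m0] := eqVneq m 0.
  by under eq_bigr do rewrite expr0z; rewrite sumr_const card_ord.
have z0 : zeta R N != 0 by have := zetaX_neq0 R N 1; rewrite expr1.
have q1 : zeta R N ^ m != 1.
  apply/eqP => zm; have : zeta R N ^+ `|m|%N = 1.
    exact: exprz_absz_eq1.
  move/eqP; rewrite -(prim_order_dvd pz) => /dvdn_leq.
  by rewrite absz_gt0 m0 => /(_ isT); lia.
have qN : (zeta R N ^ m) ^+ N = 1.
  by rewrite exprnP exprzAC -exprnP (prim_expr_order pz) exp1rz.
under eq_bigr do rewrite exprnP exprzAC -exprnP.
apply/eqP; have /eqP := subrX1 (zeta R N ^ m) N.
by rewrite qN subrr eq_sym mulf_eq0 subr_eq0 (negbTE q1).
Qed.

Lemma monom_rotate (R : realType) (r n : nat) (k : {ffun 'I_r -> 'I_n}) z e :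
  monom (rotate k z) e =
  monom z e * \prod_(j < r) (zeta R n ^+ k j) ^ e 0 j.
Proof.
rewrite /monom mulrC -big_split; apply: eq_bigr => j _.
by rewrite mxE expfzMl.
Qed.

Lemma sum_seq_single (V : zmodType) (T : eqType) (s : seq T) (F : T -> V) e :
  uniq s -> e \in s -> {in s, forall d, d != e -> F d = 0} ->
  \sum_(d <- s) F d = F e.
Proof.
move=> us es F0; rewrite (big_rem e) //= big_seq big1 ?addr0 // => d.
by rewrite (mem_rem_uniq _ us) !inE => /andP[de ds]; exact: F0.
Qed.

(** Discrete Fourier inversion. Two exponents of g differ by at most 2 M in each coordinate, so
    roots of unity of order 2 M + 1 separate all of them. *)
Lemma mcoeff_fourier (R : realType) (r M : nat) (g : laurent R r)
    (z : 'rV[R[i]]_r) (e : 'rV[int]_r) :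
  degree_le M g -> e \in msupp g ->
  \sum_(k : {ffun 'I_r -> 'I_(2 * M).+1})
    leval g (rotate k z) *
    \prod_(j < r) (zeta R (2 * M).+1 ^+ k j) ^ (- e 0 j) =
  ((2 * M).+1 ^ r)%:R * (g@_e * monom z e).
Proof.
set N := (2 * M).+1 => gM eg.
have orth d : d \in msupp g ->
    \sum_(k : {ffun 'I_r -> 'I_N})
      \prod_(j < r) (zeta R N ^+ k j) ^ (d 0 j - e 0 j) =
    if d == e then (N ^ r)%:R else 0.
  move=> dg; rewrite -(bigA_distr_bigA (fun j (l : 'I_N) =>
    (zeta R N ^+ l) ^ (d 0 j - e 0 j))) /=.
  have small j : `|d 0 j - e 0 j| < N%:Z.
    apply: le_lt_trans (ler_normB _ _) _.
    by apply: le_lt_trans (lerD (gM d dg j) (gM e eg j)) _; rewrite /N; lia.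
  under eq_bigr do rewrite sum_zeta_exprz //.
  case: eqVneq => [->|de].
    under eq_bigr do rewrite subrr eqxx.
    by rewrite prodr_const card_ord natrX.
  have [j dj] : exists j, d 0 j != e 0 j.
    apply/existsP; apply: contraR de; rewrite negb_exists => /forallP de.
    by apply/eqP/rowP => j; have := de j; rewrite negbK => /eqP.
  by apply/eqP/prodf_eq0; exists j => //; rewrite subr_eq0 (negbTE dj).
transitivity (\sum_(d <- msupp g) g@_d * monom z d *
  \sum_(k : {ffun 'I_r -> 'I_N})
    \prod_(j < r) (zeta R N ^+ k j) ^ (d 0 j - e 0 j)).
  under [RHS]eq_bigr do rewrite mulr_sumr.
  rewrite exchange_big /=; apply: eq_bigr => k _.
  rewrite /leval mulr_suml; apply: eq_bigr => d _.
  rewrite monom_rotate mulrA -mulrA; congr (_ * _).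
  rewrite -big_split; apply: eq_bigr => j _.
  by rewrite expfzDr ?zetaX_neq0.
rewrite (sum_seq_single (fset_uniq _) eg) => [|d dg de].
  by rewrite orth // eqxx mulrC.
by rewrite orth // (negbTE de) mulr0.
Qed.

(** By [mcoeff_fourier] the term is the mean of finitely many values of g on the torus through z,
    each multiplied by a number of modulus 1. *)
Lemma cauchy_estimate (R : realType) (r M : nat) (g : laurent R r)
    (z : 'rV[R[i]]_r) (e : 'rV[int]_r) (B : R) :
  degree_le M g -> e \in msupp g ->
  (forall v : 'rV[R[i]]_r, (forall j, normc (v 0 j) = normc (z 0 j)) ->
    normc (leval g v) <= B) ->
  normc (g@_e * monom z e) <= B.
Proof.
move=> gM eg gB; have /(congr1 (@normc R)) := mcoeff_fourier z gM eg.
set N := (2 * M).+1; have N0 : 0 < (N ^ r)%:R :> R by rewrite ltr0n expn_gt0.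
rewrite normcM normc_nat => sumE; rewrite -(ler_pM2l N0) -sumE.
apply: le_trans (le_normc_sum _ _ _) _.
have -> : (N ^ r)%:R * B = \sum_(k : {ffun 'I_r -> 'I_N}) B.
  by rewrite sumr_const card_ffun !card_ord mulr_natl.
apply: ler_sum => k _; rewrite normcM normc_prod big1 ?mulr1 => [|j _].
  by apply: gB => j; rewrite mxE normcM normc_zetaX mul1r.
by rewrite normc_exprz normc_zetaX exp1rz.
Qed.

(** The extra rotation shifts k_i cyclically and thus only permutes the factors. *)
Lemma leval_cyclic_prod_zeta (R : realType) (r n : nat) (f : laurent R r)
    (z : 'rV[R[i]]_r) i : (0 < n)%N -> torus z ->
  leval (cyclic_prod n f) (updc z i (zeta R n * z 0 i)) =
  leval (cyclic_prod n f) z.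
Proof.
move=> n0 zT; have pz := prim_zeta R n0.
have z1 : zeta R n != 0 by have := zetaX_neq0 R n 1; rewrite expr1.
have uT : torus (updc z i (zeta R n * z 0 i)).
  by move=> j; rewrite mxE; case: (j =P i) => _; [exact: mulf_neq0 | exact: zT].
rewrite (leval_cyclic_prodE n f uT) (leval_cyclic_prodE n f zT).
apply: esym; pose h (k : {ffun 'I_r -> 'I_n}) := updf k i (ordS (k i)).
have hI : injective h.
  move=> k k' /ffunP kk'; apply/ffunP => j; have := kk' j; rewrite !ffunE.
  by case: eqP => [->|//] /(can_inj (@ordSK n)).
rewrite (reindex_inj hI) /=; apply: eq_bigr => k _; congr leval.
apply/rowP => j; rewrite !mxE ffunE; case: eqP => [->|//] /=.
by rewrite (prim_expr_mod pz) exprSr mulrA.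
Qed.

(** Rotating coordinate i by zeta leaves the values of F unchanged but multiplies its e-th term by
    zeta^(e_i). Fourier inversion at (1, ..., 1) and at its rotation therefore gives zeta^(e_i) =
    1. *)
Lemma cyclic_prod_dvd (R : realType) (r n M : nat) (f : laurent R r) e i :
  (0 < n)%N -> degree_le M (cyclic_prod n f) -> e \in msupp (cyclic_prod n f) ->
  exists m : int, e 0 i = m * n%:Z.
Proof.
move=> n0 FM eF; set F := cyclic_prod n f in FM eF.
pose z : 'rV[R[i]]_r := const_mx 1.
have zT : torus z by move=> j; rewrite mxE oner_eq0.
have z1 : zeta R n != 0 by have := zetaX_neq0 R n 1; rewrite expr1.
have := mcoeff_fourier (updc z i (zeta R n * z 0 i)) FM eF.
set N := (2 * M).+1.
have kT (k : {ffun 'I_r -> 'I_N}) : torus (rotate k z).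
  by move=> j; rewrite mxE mulf_neq0 ?zetaX_neq0.
have rotE (k : {ffun 'I_r -> 'I_N}) : rotate k (updc z i (zeta R n * z 0 i)) =
    updc (rotate k z) i (zeta R n * rotate k z 0 i).
  by apply/rowP => j; rewrite !mxE; case: eqP => [->|//]; rewrite mulrCA.
under eq_bigr do rewrite rotE leval_cyclic_prod_zeta //.
rewrite (mcoeff_fourier z FM eF) -/N.
have N0 : (N ^ r)%:R != 0 :> R[i] by rewrite pnatr_eq0 expn_eq0.
move/(mulfI N0)/mulfI; rewrite mcoeff_neq0 => /(_ eF).
have -> : monom z e = 1.
  by rewrite /monom big1 // => j _; rewrite mxE exp1rz.
rewrite monom_updc mxE mulr1 big1 ?mulr1; last first.
  by move=> j _; rewrite mxE exp1rz.
move/esym => zn; have pz := prim_zeta R n0.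
have dvd : (n %| `|(e 0 i)%R|)%N.
  by rewrite (prim_order_dvd pz) exprz_absz_eq1.
exists (sgz (e 0 i) * (`|(e 0 i)%R| %/ n)%N%:Z).
by rewrite -mulrA -PoszM divnK // -intEsg.
Qed.

(** * Degrees and numbers of terms *)

Lemma degree_leS (R : realType) (r D : nat) (f : laurent R r)
    (S : {fset 'rV[int]_r}) :
  (msupp f `<=` S)%fset -> (forall e, e \in S -> forall i, `|e 0 i| <= D%:Z) ->
  degree_le D f.
Proof. by move=> /fsubsetP fS SD e /fS; exact: SD. Qed.

Lemma degree_le_sum (R : realType) (r D : nat) (I : eqType) (s : seq I)
    (F : I -> laurent R r) :
  {in s, forall i, degree_le D (F i)} -> degree_le D (\sum_(i <- s) F i).
Proof.
move=> FD; rewrite big_seq; elim/big_ind: _ => [|f g fD gD|//].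
  by move=> e; rewrite msupp0 inE.
apply: degree_leS (msuppD_le f g) _ => e; rewrite inE => /orP[/fD|/gD]; exact.
Qed.

Lemma degree_leU (R : realType) (r D : nat) (c : R[i]) (e : 'rV[int]_r) :
  (forall i, `|e 0 i| <= D%:Z) -> degree_le D (<< c *g e >> : laurent R r).
Proof.
move=> eD; apply: degree_leS msuppU_le _ => d; rewrite inE => /eqP->; exact: eD.
Qed.

Lemma degree_le1 (R : realType) (r : nat) : degree_le 0 (1 : laurent R r).
Proof. by apply: degree_leU => i; rewrite mxE normr0. Qed.

Lemma degree_leM (R : realType) (r D D' : nat) (f g : laurent R r) :
  degree_le D f -> degree_le D' g -> degree_le (D + D') (f * g).
Proof.
move=> fD gD; apply: degree_le_sum => d df; apply: degree_le_sum => e eg.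
apply: degree_leU => i; rewrite mxE; apply: le_trans (ler_normD _ _) _.
by rewrite PoszD lerD ?fD ?gD.
Qed.

Lemma degree_le_rescale (R : realType) (r D : nat) u (f : laurent R r) :
  degree_le D f -> degree_le D (rescale u f).
Proof.
by move=> fD; apply: degree_le_sum => e ef; apply: degree_leU => i; exact: fD.
Qed.

Lemma degree_le_cyclic_prod (R : realType) (r D n : nat) (f : laurent R r) :
  degree_le D f -> degree_le (n ^ r * D) (cyclic_prod n f).
Proof.
move=> fD; have -> : (n ^ r * D = \sum_(k : {ffun 'I_r -> 'I_n}) D)%N.
  by rewrite sum_nat_const card_ffun !card_ord.
rewrite /cyclic_prod; elim/big_ind2: _ => [||k _].
- exact: degree_le1.
- by move=> d g d' g'; exact: degree_leM.
- exact: degree_le_rescale.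
Qed.

Lemma degree_le_exists (R : realType) (r : nat) (f : laurent R r) :
  exists D, degree_le D f.
Proof.
exists (\max_(e <- msupp f) \max_(i < r) `|(e 0 i)%R|%N) => e ef i.
rewrite -abszE lez_nat (leq_trans _ (leq_bigmax_seq _ ef _)) //.
exact: (leq_bigmax i).
Qed.

(** Adding M to every exponent embeds the support into the box {0, ..., 2 M}^r. *)
Lemma size_msupp_le (R : realType) (r M : nat) (g : laurent R r) :
  degree_le M g -> (size (msupp g) <= (2 * M).+1 ^ r)%N.
Proof.
move=> gM; pose h (e : 'rV[int]_r) : {ffun 'I_r -> 'I_(2 * M).+1} :=
  [ffun j => inord `|(e 0 j + M%:Z)%R|%N].
have hI : {in msupp g &, injective h}.
  move=> d e dg eg /ffunP de; apply/rowP => j; have := congr1 val (de j).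
  have := gM d dg j; have := gM e eg j; rewrite !ffunE.
  move: (d 0 j) (e 0 j) => a b aM bM /=; rewrite !inordK; lia.
rewrite -(size_map h).
have hu : uniq [seq h e | e <- msupp g] by rewrite map_inj_in_uniq ?fset_uniq.
rewrite -(card_uniqP hu); apply: leq_trans (max_card _) _.
by rewrite card_ffun !card_ord.
Qed.

(** * Lopsided and superlopsided lists *)

(** Each entry is minus the sum of the others, so the triangle inequality bounds its modulus by the
    sum of theirs. *)
Lemma not_lopsided_sum0 (R : realType) (s : seq R[i]) :
  \sum_(x <- s) x = 0 -> ~ lopsided [seq normc x | x <- s].
Proof.
move=> s0; case=> i; apply/negP; rewrite -leNgt.
have nthE (j : 'I_(size [seq normc x | x <- s])) :
    [seq normc x | x <- s]`_j = normc s`_j.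
  by rewrite (nth_map 0) // -(size_map (@normc R)).
under eq_bigr do rewrite nthE.
rewrite nthE; apply: le_trans (le_normc_sum _ _ _).
move: s0; rewrite (big_nth 0) -(size_map (@normc R)) big_mkord (bigD1 i) //=.
move/eqP; rewrite addr_eq0 => /eqP->.
by rewrite -sub0r normcB subr0.
Qed.

Lemma superlopsided_lopsided (R : realType) (s : seq R) :
  {in s, forall x, 0 < x} -> superlopsided s -> lopsided s.
Proof.
move=> s0 [i si]; exists i.
have card_ne : #|[pred j : 'I_(size s) | j != i]| = (size s).-1.
  by rewrite -[in RHS](card_ord (size s)) -(cardC1 i); apply: eq_card.
(* For a single entry the sum of the others is 0, and positivity of the entry decides. Otherwise the
   inequalities for all j other than i are added. *)
have [m0|m0] := posnP (size s).-1.
  rewrite big_pred0 ?s0 ?mem_nth // => j.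
  by have := card0_eq (etrans card_ne m0) j.
have m0R : 0 < (size s).-1%:R :> R by rewrite ltr0n.
rewrite -(ltr_pM2l m0R) mulr_sumr.
have -> : (size s).-1%:R * s`_i = \sum_(j < size s | j != i) s`_i.
  by rewrite sumr_const card_ne mulr_natl.
apply: ltr_sum => [|j ji]; last exact: si.
rewrite -card_ne in m0; case/card_gt0P: m0 => j ji.
by apply/hasP; exists j; rewrite ?mem_index_enum.
Qed.

Lemma superlopsided_map (R : realType) (T : eqType) (s : seq T) (b : T -> R) d :
  uniq s -> d \in s ->
  {in s, forall e, e != d -> (size s).-1%:R * b e < b d} ->
  superlopsided [seq b e | e <- s].
Proof.
move=> us ds sb; have di : (index d s < size [seq b e | e <- s])%N.
  by rewrite size_map index_mem.
exists (Ordinal di) => j ji; have js : (j < size s)%N by rewrite -(size_map b).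
rewrite [X in X.-1]size_map (nth_map d) // (nth_map d) ?index_mem //=.
rewrite nth_index //.
apply: sb; first exact: mem_nth.
by apply: contra ji => /eqP jd; rewrite -val_eqE /= -jd index_uniq.
Qed.

(** * Asymptotics in n *)

(** The term of degree m + 1 of the exponential series at n delta is c n^(m+1), which exceeds C n^m
    once c n >= C. *)
Lemma geometric_decay (R : realType) (C delta : R) m : 0 <= C -> 0 < delta ->
  exists N, forall n, (N <= n)%N -> C * n%:R ^+ m * expR delta ^- n < 1.
Proof.
move=> C0 delta0; pose c := delta ^+ m.+1 / (m.+1)`!%:R.
have c0 : 0 < c by rewrite divr_gt0 ?exprn_gt0 // ltr0n fact_gt0.
exists (Num.bound (C / c)) => n Nn.
have Cn : C <= c * n%:R.
  rewrite mulrC -ler_pdivrMr //.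
  apply/ltW/(lt_le_trans (archi_boundP _)); first by rewrite divr_ge0 // ltW.
  by rewrite ler_nat.
rewrite ltr_pdivrMr ?exprn_gt0 ?expR_gt0 // mul1r -expRM_natl.
have nd0 : 0 <= n%:R * delta by rewrite mulr_ge0 // ltW.
apply: lt_le_trans (expR_ge1Dxn m nd0); rewrite ltr_pwDl // ?ltr01 //.
have -> : (n%:R * delta) ^+ m.+1 / (m.+1)`!%:R = c * n%:R * n%:R ^+ m.
  by rewrite exprMn [n%:R ^+ m.+1]exprS /c; ring.
by rewrite ler_wpM2r ?exprn_ge0.
Qed.

(** For eta <= 1/2 one has (1 + eta) / (1 - eta) <= 1 + 4 eta <= exp(4 eta), and the m-th power of
    the latter is at most exp(ln 2). *)
Lemma distortion_expr_le2 (R : realType) (E : R) n m :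
  1 < E -> 2 * E ^- n <= 1 -> 4 * m%:R * E ^- n <= ln 2 ->
  distortion E n ^+ m <= 2.
Proof.
move=> E1 En mE; have E0 := lt_trans ltr01 E1.
have eta0 : 0 < E ^- n by rewrite invr_gt0 exprn_gt0.
have dE : distortion E n <= expR (4 * E ^- n).
  apply: le_trans (expR_ge1Dx _); rewrite /distortion ler_pdivrMr; last by lra.
  by nra.
apply: (@le_trans _ _ (expR (4 * E ^- n) ^+ m)).
  rewrite lerXn2r ?nnegrE ?expR_ge0 // divr_ge0; lra.
rewrite -expRM_natl -[leRHS](@lnK R 2) ?posrE // ler_expR.
by apply: le_trans mE; rewrite mulrCA mulrA.
Qed.

(** * Inclusions between the amoeba and its approximations *)

(** At a zero of f the factor of the trivial rotation vanishes, so the terms of the cyclic product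
    add up to 0 there. *)
Lemma amoeba_sub_LA (R : realType) (r n : nat) (f : laurent R r) :
  (0 < n)%N -> (amoeba f `<=` LA (cyclic_prod n f))%classic.
Proof.
move=> n0 _ [z [zT fz] <-]; rewrite /LA /= list_at_Log // /term_norms.
rewrite (map_comp (@normc R) (fun e => (cyclic_prod n f)@_e * monom z e)).
apply: not_lopsided_sum0; rewrite big_map.
rewrite -[LHS]/(leval (cyclic_prod n f) z) leval_cyclic_prodE //.
apply/eqP/prodf_eq0; exists [ffun=> Ordinal n0] => //; apply/eqP.
rewrite -[RHS]fz; congr leval.
by apply/rowP => j; rewrite mxE ffunE expr0 mul1r.
Qed.

Definition exp_point (R : realType) (r : nat) (a : 'rV[R]_r) : 'rV[R[i]]_r :=
  \row_j (expR (a 0 j))%:C.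

Lemma normc_exp_point (R : realType) (r : nat) (a : 'rV[R]_r) j :
  normc (exp_point a 0 j) = expR (a 0 j).
Proof. by rewrite mxE normc_real ?expR_ge0. Qed.

Lemma exp_pointT (R : realType) (r : nat) (a : 'rV[R]_r) : torus (exp_point a).
Proof. by move=> j; rewrite -normc_gt0 normc_exp_point expR_gt0. Qed.

Lemma LA_sub_SA (R : realType) (r : nat) (g : laurent R r) :
  (LA g `<=` SA g)%classic.
Proof.
move=> a aL aS; apply: aL; apply: superlopsided_lopsided aS => x /mapP[e eg ->].
rewrite normc_gt0 mulf_neq0 ?mcoeff_neq0 // /monom.
apply/prodf_neq0 => j _; apply: expfz_neq0; exact: exp_pointT.
Qed.

(** * Superlopsidedness away from the amoeba *)

(** A zero v would have all coordinates of Log v within 2 delta = eps / (r + 1) of those of a, hence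
    Euclidean distance at most eps sqrt(r) / (r + 1) < eps. *)
Lemma leval_neq0_near_torus (R : realType) (r : nat) (f : laurent R r)
    (a : 'rV[R]_r) (eps delta : R) :
  0 < eps -> delta = eps / (2 * r.+1%:R) ->
  (forall b, amoeba f b -> eps <= eucl_dist a b) ->
  forall v, near_torus (\row_j expR (a 0 j)) (expR delta ^+ 2) v ->
  leval f v != 0.
Proof.
move=> eps0 deltaE far v vE; apply/eqP => fv.
have rho0 j : 0 < (\row_j expR (a 0 j) : 'rV[R]_r) 0 j by rewrite mxE expR_gt0.
have vT := near_torus_torus rho0 (exprn_gt0 2 (expR_gt0 delta)) vE.
have /far : amoeba f (Log v) by exists v.
apply/negP; rewrite -ltNge /eucl_dist.
rewrite -[ltRHS](ger0_norm (ltW eps0)) -sqrtr_sqr ltr_sqrt ?exprn_gt0 //.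
have le j : (a 0 j - Log v 0 j) ^+ 2 <= (2 * delta) ^+ 2.
  have v0 : 0 < normc (v 0 j) by rewrite normc_gt0.
  have := vE j; rewrite -expRM_natl !mxE -expRN -!expRD.
  rewrite -[X in _ <= X <= _]lnK ?posrE // !ler_expR => /andP[v1 v2].
  by rewrite -subr_ge0 subr_sqr mulr_ge0; lra.
apply: le_lt_trans (ler_sum _ (fun j _ => le j)) _.
rewrite sumr_const card_ord.
have -> : 2 * delta = eps / r.+1%:R by rewrite deltaE; field.
rewrite -[ltLHS]mulr_natr expr_div_n mulrAC ltr_pdivrMr ?exprn_gt0 //.
rewrite ltr_pM2l ?exprn_gt0 // -natrX ltr_nat.
by rewrite expnS expn1 mulSn; lia.
Qed.

Lemma cyclic_prod_term_le (R : realType) (r n D : nat) (f : laurent R r)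
    (a : 'rV[R]_r) (E : R) :
  (0 < n)%N -> 1 < E -> degree_le D f ->
  (forall v, near_torus (\row_j expR (a 0 j)) (E ^+ 2) v -> leval f v != 0) ->
  exists d : 'rV[int]_r, forall e, e \in msupp (cyclic_prod n f) -> e != d ->
    normc ((cyclic_prod n f)@_e * monom (exp_point a) e) <=
    cyclic_distortion r D n E ^+ r.+1 * E ^- n *
    normc (leval (cyclic_prod n f) (exp_point a)).
Proof.
move=> n0 E1 fD f0; set F := cyclic_prod n f; set z := exp_point a.
set rho : 'rV[R]_r := \row_j expR (a 0 j) in f0.
have E0 := lt_trans ltr01 E1.
have rho0 j : 0 < rho 0 j by rewrite mxE expR_gt0.
have zrho j : normc (z 0 j) = rho 0 j by rewrite normc_exp_point mxE.
have rhoE j : rho 0 j / E <= rho 0 j <= rho 0 j * E.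
  by rewrite ler_pdivrMr // !ler_peMr // ltW.
have /choice[p pP] i := cyclic_prod_torus_le i n0 rho0 E1 fD f0 zrho.
(* The candidate for the dominant exponent is the one whose monomial grows like the bounds for F in
   every coordinate. *)
exists (\row_i (p i * n%:Z)) => e eF ed.
have FD : degree_le (n ^ r * D) F := degree_le_cyclic_prod fD.
have [i ei] : exists i, e 0 i != p i * n%:Z.
  apply/existsP; apply: contraR ed; rewrite negb_exists => /forallP ed.
  by apply/eqP/rowP => j; have := ed j; rewrite negbK mxE => /eqP.
have [m em] := cyclic_prod_dvd i n0 FD eF.
have mp : m != p i by apply: contra ei => /eqP <-; rewrite em.
set b := normc _; set A := normc (leval F z); set C := _ ^+ r.+1.
have C0 : 0 <= C.
  exact/exprn_ge0/(le_trans ler01)/cyclic_distortion_ge1.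
have A0 : 0 <= A by exact: normc_ge0.
(* Cauchy estimate with |z_i| scaled by t: the term scales by t^(n m), the bound for F by t^(n
   p_i). *)
have shift t : 0 < t -> E^-1 <= t <= E -> b <= C * (t ^+ n) ^ (p i - m) * A.
  move=> t0 tE; pose z' := updc z i (z 0 i * t%:C).
  have zi' : normc (z 0 i * t%:C) = rho 0 i * t.
    by rewrite normcM normc_real ?(ltW t0) // zrho.
  have tn0 : 0 < t ^+ n by rewrite exprn_gt0.
  have : normc (F@_e * monom z' e) <= C * (t ^+ n) ^ p i * A.
    apply: (cauchy_estimate FD eF) => v vz'.
    have vE : near_torus rho E v.
      move=> j; rewrite vz'; case: (eqVneq j i) => [->|ji].
        by rewrite updcE zi' !ler_pM2l.
      by rewrite updcNE // zrho.
    have := pP i v vE; rewrite vz' updcE zi'.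
    rewrite [_ / rho 0 i]mulrAC divff ?gt_eqF // mul1r.
    by apply=> j ji; rewrite vz' updcNE // zrho.
  have -> : normc (F@_e * monom z' e) = b * (t ^+ n) ^ m.
    have -> : monom z' e = monom z e * t%:C ^ e 0 i.
      by rewrite -[in RHS](updc_id z i) !monom_updc expfzMl mulrAC.
    rewrite mulrA normcM normc_exprz normc_real ?(ltW t0) // em mulrC.
    by rewrite mulrC [m * _]mulrC -exprz_exp -exprnP.
  rewrite -ler_pdivlMr ?exprz_gt0 // => /le_trans; apply.
  by rewrite expfzDr ?gt_eqF // invr_expz mulrAC !mulrA.
have eta0 : 0 < E ^- n by rewrite invr_gt0 exprn_gt0.
have eta1 := ltW (exprVn_lt1 E1 n0).
have E11 : E^-1 <= 1 by rewrite invf_le1 // ltW.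
have le_eta k : C * (E ^- n) ^+ k.+1 * A <= C * E ^- n * A.
  rewrite ler_wpM2r // ler_wpM2l // exprS ler_piMr ?(ltW eta0) //.
  by rewrite exprn_ile1 // ltW.
have E11E := le_trans E11 (ltW E1).
have pm0 : p i - m != 0 by rewrite subr_eq0 eq_sym.
(* The sign of p_i - m selects t = E^-1 or t = E. The integers m and p_i differ by at least 1, so
   the gain is at least a factor E^-n. *)
case: (intP (p i - m)) shift pm0 => [|k|k] shift // _.
  have := shift E^-1; rewrite invr_gt0 E0 lexx -exprnP exprVn E11E.
  by move=> /(_ isT isT)/le_trans; apply; exact: le_eta.
have := shift E; rewrite E0 lexx -exprnN -exprVn E11E.
by move=> /(_ isT isT)/le_trans; apply; exact: le_eta.
Qed.

Lemma superlopsided_far (R : realType) (r n D : nat) (f : laurent R r)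
    (a : 'rV[R]_r) (E : R) :
  (0 < n)%N -> 1 < E -> degree_le D f ->
  (forall v, near_torus (\row_j expR (a 0 j)) (E ^+ 2) v -> leval f v != 0) ->
  cyclic_distortion r D n E ^+ r.+1 <= 2 ->
  4 * ((2 * (n ^ r * D)).+1 ^ r)%:R * E ^- n < 1 ->
  superlopsided (list_at (cyclic_prod n f) a).
Proof.
move=> n0 E1 fD f0 C2 Sn.
have [d dP] := cyclic_prod_term_le n0 E1 fD f0.
set F := cyclic_prod n f in dP *; set z := exp_point a in dP.
set A := normc (leval F z) in dP.
have eta0 : 0 < E ^- n by rewrite invr_gt0 exprn_gt0 // (lt_trans ltr01).
set eta := E ^- n in dP Sn eta0.
have rho0 j : 0 < (\row_j expR (a 0 j) : 'rV[R]_r) 0 j by rewrite mxE expR_gt0.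
have A0 : 0 < A.
  rewrite normc_gt0 /F leval_cyclic_prodE; last exact: exp_pointT.
  apply/prodf_neq0 => k _; apply/f0/near_torus_rotate => j.
  rewrite normc_exp_point mxE.
  have E2 : 1 <= E ^+ 2 by rewrite exprn_ege1 // ltW.
  by rewrite ler_pdivrMr ?(lt_le_trans ltr01) // !ler_peMr ?expR_ge0.
pose b e := normc (F@_e * monom z e).
have bd e : e \in msupp F -> e != d -> b e <= 2 * eta * A.
  move=> eF ed; apply: le_trans (dP e eF ed) _.
  by rewrite ler_wpM2r ?(ltW A0) // ler_wpM2r // ltW.
have sF : (size (msupp F))%:R <= ((2 * (n ^ r * D)).+1 ^ r)%:R :> R.
  by rewrite ler_nat size_msupp_le //; exact: degree_le_cyclic_prod.
(* With C <= 2, each term other than the d-th is at most 2 eta A; the bound on the number of terms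
   keeps even their total below A / 2. *)
have small : (size (msupp F))%:R * (2 * eta * A) < A / 2.
  rewrite -(ltr_pM2l A0) mulr1 in Sn.
  have : 0 <= 2 * eta * A by rewrite !mulr_ge0 // ltW.
  by move/(ler_wpM2r)/(_ _ _ sF); lra.
have sumA : A <= \sum_(e <- msupp F) b e by exact: le_normc_sum.
have sum_le (s : seq 'rV[int]_r) : {in s, forall e, b e <= 2 * eta * A} ->
    \sum_(e <- s) b e <= (size s)%:R * (2 * eta * A).
  have -> : (size s)%:R * (2 * eta * A) = \sum_(e <- s) (2 * eta * A).
    by rewrite big_const_seq count_predT iter_addr_0 mulr_natl.
  by move=> sb; rewrite big_seq [leRHS]big_seq; apply: ler_sum.
(* Without the term d all terms would be small, and their sum could not reach A. *)
have dF : d \in msupp F.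
  apply: contraT => dF; suff : A < A by rewrite ltxx.
  have /sum_le : {in msupp F, forall e, b e <= 2 * eta * A}.
    by move=> e eF; apply: bd => //; apply: contraNneq dF => <-.
  by lra.
rewrite /list_at -/(term_norms _ _).
apply: (superlopsided_map (fset_uniq _) dF).
move=> e eF ed; have bed := bd e eF ed.
have := sumA; rewrite (big_rem d) //= => sumA'.
have /sum_le : {in rem d (msupp F), forall e, b e <= 2 * eta * A}.
  move=> e'; rewrite (mem_rem_uniq _ (fset_uniq _)) !inE => /andP[ed' eF'].
  exact: bd.
rewrite size_rem // => sumr_le.
have m_le : (size (msupp F)).-1%:R <= (size (msupp F))%:R :> R.
  by rewrite ler_nat leq_pred.
have eA0 : 0 <= 2 * eta * A by rewrite !mulr_ge0 // ltW.
have h1 := ler_wpM2r eA0 m_le.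
have h2 : (size (msupp F)).-1%:R * b e <=
    (size (msupp F)).-1%:R * (2 * eta * A).
  by rewrite ler_wpM2l.
(* The other terms add up to less than A / 2, so b d > A / 2, which exceeds (size - 1) b e. *)
by rewrite -/(b e) -/(b d); lra.
Qed.

(** * Uniform convergence *)

Lemma SA_close (R : realType) (r : nat) (f : laurent R r) (eps : R) : 0 < eps ->
  exists N : nat, forall n, (0 < n)%N -> (N <= n)%N ->
  forall a, SA (cyclic_prod n f) a -> (dist_to (amoeba f) a < eps%:E)%E.
Proof.
move=> eps0; have [D fD] := degree_le_exists f.
pose delta := eps / (2 * r.+1%:R); pose E := expR delta.
have delta0 : 0 < delta by rewrite divr_gt0 ?mulr_gt0.
have E1 : 1 < E by rewrite expR_gt1.
have ln2 : 0 < ln 2 :> R by rewrite ln_gt0 // ltr1n.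
(* [N1] and [N2] serve the two smallness conditions of [distortion_expr_le2], with exponent 2 D (r +
   1) n^r. [N3] controls the number of terms, which is O(n^(r r)). *)
have [N1 H1] := geometric_decay 0 (ler0n R 2) delta0.
have C2 : 0 <= 4 * (2 * D * r.+1)%:R / ln 2 :> R.
  by rewrite divr_ge0 ?mulr_ge0 // ltW.
have [N2 H2] := geometric_decay r C2 delta0.
have C3 : 0 <= 4 * ((2 * D).+1 ^ r)%:R :> R by rewrite mulr_ge0.
have [N3 H3] := geometric_decay (r * r) C3 delta0.
exists (maxn N1 (maxn N2 N3)) => n n0; rewrite !geq_max => /and3P[n1 n2 n3].
have {n1} := H1 n n1; have {n2} := H2 n n2; have {n3} := H3 n n3.
rewrite -/E => h3 h2 h1 a aS; rewrite ltNge; apply/negP => far.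
have eta0 : 0 < E ^- n by rewrite invr_gt0 exprn_gt0 // expR_gt0.
apply: aS; apply: (superlopsided_far n0 E1 fD).
(* The infimum bounds every distance from below; for an empty amoeba there is nothing to bound. *)
- apply: (leval_neq0_near_torus eps0 erefl) => b bA.
  rewrite -lee_fin; apply: le_trans far _.
  by apply: ereal_inf_lbound; exists b.
- rewrite /cyclic_distortion -exprM; apply: distortion_expr_le2 => //.
    by rewrite expr0 mulr1 in h1; exact: ltW.
  have scale : 4 * (2 * D * r.+1)%:R / ln 2 * n%:R ^+ r * E ^- n =
      4 * (2 * D * n ^ r * r.+1)%:R * E ^- n / ln 2 :> R.
    by rewrite !natrM natrX; ring.
  by rewrite scale ltr_pdivrMr // mul1r in h2; exact: ltW.
apply: le_lt_trans h3; rewrite ler_wpM2r ?(ltW eta0) // -mulrA ler_wpM2l //.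
(* This reduces to 2 D n^r + 1 <= (2 D + 1) n^r, which holds because n >= 1. *)
rewrite -natrX -natrM ler_nat mulnC expnM -expnMn.
have leX x y k : (x <= y)%N -> (x ^ k <= y ^ k)%N.
  by case: k => // k; rewrite leq_exp2r.
apply: leX; rewrite mulSn -mulnA mulnC [(D * 2)%N]mulnC.
by rewrite -[X in (X < _)%N]add0n ltn_add2r expn_gt0 n0.
Qed.

Theorem corollary3p6 (R : realType) (r : nat) (f : laurent R r) :
  converges_uniformly_to (fun n => SA (cyclic_prod n f)) (amoeba f) /\
  converges_uniformly_to (fun n => LA (cyclic_prod n f)) (amoeba f).
Proof.
split; split => [n n0 a aA|eps eps0].
- exact/LA_sub_SA/amoeba_sub_LA.
- exact: SA_close.
- exact: amoeba_sub_LA.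
have [N HN] := SA_close f eps0.
by exists N => n n0 Nn a aL; apply: (HN n n0 Nn); exact: LA_sub_SA.
Qed.
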